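(* For every $\varepsilon>0$ and every integer $k\geq 3$, Maker wins the bichromatic one-round Maker-Breaker game with bias $1:(2-\varepsilon)$: there exist $n\in\mathbb{N}$ and a set $M$ of $n$ points in the plane in general position such that for every set $B$ of at most $(2-\varepsilon)n$ points with $M\cap B=\emptyset$ and $M\cup B$ in general position, there is a $k$-hole $H$ of $M\cup B$ with $H\subseteq M$.
   Context: A $k$-hole of a finite point set $S\subset\mathbb{R}^2$ is a subset $H\subseteq S$ of size $k$ such that $\mathrm{conv}(H)$ is a convex $k$-gon and $\mathrm{conv}(H)\cap S=H$. In the bichromatic one-round game with bias $1:s$, Maker first places a set $M$ of $n$ points in general position (no three collinear), then Breaker places a set $B$ of at most $sn$ points disjoint from $M$ such that $M\cup B$ is in general position; Maker wins iff some $k$-hole of $M\cup B$ is contained in $M$. *)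

(* Defs.v *)
From HB Require Import structures.
From mathcomp Require Import all_boot all_order all_algebra finmap.
From mathcomp Require Import all_classical all_reals interval_inference.
From mathcomp Require Import convex.

Set Implicit Arguments.
Unset Strict Implicit.
Unset Printing Implicit Defensive.

Import Order.TTheory GRing.Theory Num.Theory.

Local Open Scope classical_set_scope.
Local Open Scope ring_scope.
Local Open Scope convex_scope.

Notation plane R := 'rV[R]_2.

Section Geometry.
Variable R : realType.
Implicit Types (A P : set (plane R)) (S H : {fset plane R}).

Definition line (a v : plane R) : set (plane R) :=
  [set p | exists t : R, p = a + t *: v].

Definition collinear A : Prop :=
  exists a v : plane R, v != 0 /\ A `<=` line a v.

Definition general_position S : Prop :=
  forall T : {fset plane R},
    (T `<=` S)%fset -> #|` T| = 3%N -> ~ collinear [set` T].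

Definition convex_hull A : set (plane R) :=
  smallest (fun C => convex_set (C : set (convex_lmodType (plane R)))) A.

Definition extreme_points A : set (plane R) :=
  [set x | A x /\
    forall (y z : convex_lmodType (plane R)) (t : {i01 R}),
      A y -> A z -> 0 < t%:num -> t%:num < 1 ->
      x = y <| t |> z -> y = x /\ z = x].

(* A polygon is the convex hull of its vertices, and the vertices are its
   extreme points.  With at least three of them the polygon is nondegenerate,
   since a convex subset of a line has at most two extreme points. *)
Definition convex_polygon (k : nat) P : Prop :=
  (3 <= k)%N /\
  exists V : {fset plane R},
    [/\ #|` V| = k, P = convex_hull [set` V] & extreme_points P = [set` V]].

Definition hole (k : nat) S H : Prop :=
  [/\ (H `<=` S)%fset,
      #|` H| = k,
      convex_polygon k (convex_hull [set` H])
    & convex_hull [set` H] `&` [set` S] = [set` H]].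

End Geometry.

(* Main.v *)
(* Maker plays a generic projection of the grid [m]^D to the plane, D much larger
   than m, in which every line in a coordinate direction is bent slightly into a
   flat parabola. Any k points on such a line form a k-hole of Maker's set, so
   Breaker has to put about m - k points into the hull of each of the D m^(D-1)
   lines, or else a point that is "deep", i.e. not confined to the ear of one
   vertex. Three lines of the projected grid rarely meet outside the grid, and
   the curvatures of different directions have very different scales, so one
   point is deep for only O(m) lines. Otherwise it is close to a grid vertex and
   sees it from the inside of the parabolas. As consecutive directions bend to
   opposite sides, this happens for only about half of the D directions, so that
   Breaker needs about D m^D / (D/2) = 2 m^D points. *)

Require Import Defs.
From HB Require Import structures.
From mathcomp Require Import all_boot all_order all_algebra finmap.
From mathcomp Require Import all_classical all_reals.
From mathcomp Require Import interval_inference convex zify ring lra.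

Set Implicit Arguments.
Unset Strict Implicit.
Unset Printing Implicit Defensive.

Import Order.TTheory GRing.Theory Num.Theory.

Local Open Scope ring_scope.

(** * Convex hulls in the plane *)

Section ConvexHull.
Variable R : realType.
Implicit Types (A : set (plane R)) (p q x : plane R) (a b c : R).

Definition lform a b p : R := a * p 0 0 + b * p 0 1.

Local Open Scope classical_set_scope.
Local Open Scope convex_scope.

Lemma lform_conv a b (p q : convex_lmodType (plane R)) (t : {i01 R}) :
  lform a b (p <| t |> q) =
    t%:num * lform a b p + (1 - t%:num) * lform a b q.
Proof. by rewrite /lform /conv/= !mxE /unstable.onem; ring. Qed.

Lemma subset_hull A : A `<=` convex_hull A.
Proof. exact: sub_gen_smallest. Qed.

Lemma hull_convex A :
  convex_set (convex_hull A : set (convex_lmodType (plane R))).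
Proof.
move=> p q t; rewrite !inE => pA qA C [/= CC AC].
by apply/set_mem/CC; apply/mem_set; [exact: pA|exact: qA].
Qed.

Lemma hull_mono A A' : A `<=` A' -> convex_hull A `<=` convex_hull A'.
Proof.
by move=> AA'; apply: smallest_sub; [exact: hull_convex|
  exact: subset_trans AA' (@subset_hull _)].
Qed.

Lemma hull_ge a b c A :
  (forall p, A p -> c <= lform a b p) ->
  forall p, convex_hull A p -> c <= lform a b p.
Proof.
move=> cA; apply: smallest_sub => // p q t; rewrite !inE lform_conv.
have t0 : 0 <= t%:num by []; have t1 : t%:num <= 1 by []; move=> cp cq.
have := mulr_ge0 t0 (_ : 0 <= lform a b p - c).
have := mulr_ge0 (_ : 0 <= 1 - t%:num) (_ : 0 <= lform a b q - c).
by rewrite !subr_ge0 => /(_ t1 cq) + /(_ cp); lra.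
Qed.

(** An open half-plane together with one boundary point [x] is convex. *)
Lemma hull_gt a b A x :
  (forall p, A p -> p = x \/ lform a b x < lform a b p) ->
  forall p, convex_hull A p -> p = x \/ lform a b x < lform a b p.
Proof.
move=> cA; apply: smallest_sub => //; apply/convex_setW => p q.
rewrite !inE => cp cq t t0; rewrite -subr_gt0 inE => t1.
have aux u : u = x \/ lform a b x < lform a b u -> lform a b x <= lform a b u.
  by case=> [->|/ltW].
case: (cp) => [px|px].
  case: (cq) => [qx|qx]; first by left; rewrite px qx convmm.
  right; rewrite lform_conv px.
  by have := mulr_gt0 t1 (_ : 0 < lform a b q - lform a b x);
    rewrite subr_gt0 => /(_ qx); lra.
right; rewrite lform_conv.
have := mulr_gt0 t0 (_ : 0 < lform a b p - lform a b x).
have := mulr_ge0 (ltW t1) (_ : 0 <= lform a b q - lform a b x).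
by rewrite subr_gt0 subr_ge0 => /(_ (aux _ cq)) + /(_ px); lra.
Qed.

(** An extreme point outside [A] could be deleted from the hull, leaving a smaller convex set that
    contains [A]. *)
Lemma extreme_hull_sub A : extreme_points (convex_hull A) `<=` A.
Proof.
move=> x [xA xE]; apply: contrapT => nAx.
suff /(_ x xA) : convex_hull A `<=` convex_hull A `\ x by case=> _ /(_ erefl).
apply: smallest_sub; last first.
  by move=> p Ap; split; [exact: subset_hull|move=> /= px; rewrite px in Ap].
apply/convex_setW => p q; rewrite !inE => -[pA px] [qA qx] t t0 t1.
rewrite inE; split.
  by apply/set_mem/hull_convex; apply/mem_set.
move=> /= xE'; have [px' _] := xE p q t pA qA t0 t1 (esym xE').
exact: px.
Qed.

Lemma extreme_points_hull A :
  (forall x, A x -> exists a b,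
     forall p, A p -> p = x \/ lform a b x < lform a b p) ->
  extreme_points (convex_hull A) = A.
Proof.
move=> sepA; apply/seteqP; split; first exact: extreme_hull_sub.
move=> x Ax; split; first exact: subset_hull.
have [a [b sepx]] := sepA x Ax.
move=> y z t yA zA t0; rewrite -subr_gt0 => t1 xE.
have xL : lform a b x = t%:num * lform a b y + (1 - t%:num) * lform a b z.
  by rewrite -lform_conv -xE.
clear xE.
case: (hull_gt sepx yA) => [yx|xy]; case: (hull_gt sepx zA) => [zx|xz] //;
  exfalso.
- have := mulr_gt0 t1 (_ : 0 < lform a b z - lform a b x).
  by rewrite subr_gt0 => /(_ xz); rewrite yx in xL; lra.
- have := mulr_gt0 t0 (_ : 0 < lform a b y - lform a b x).
  by rewrite subr_gt0 => /(_ xy); rewrite zx in xL; lra.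
- have := mulr_gt0 t0 (_ : 0 < lform a b y - lform a b x).
  have := mulr_gt0 t1 (_ : 0 < lform a b z - lform a b x).
  by rewrite !subr_gt0 => /(_ xz) + /(_ xy); lra.
Qed.

Lemma collinear_det A p q x : collinear A -> A p -> A q -> A x ->
  (q 0 0 - p 0 0) * (x 0 1 - p 0 1) = (x 0 0 - p 0 0) * (q 0 1 - p 0 1).
Proof.
move=> [u [v [_ Al]]] /Al[tp ->] /Al[tq ->] /Al[tx ->].
by rewrite !mxE; ring.
Qed.

End ConvexHull.
(** * Expansions in a large base *)

Section Digits.

(** The lowest digit is a multiple of [T] of size less than [T], hence zero; divide by [T] and
    repeat. *)
Lemma digits_eq0 (T : int) n (c : 'I_n -> int) :
  (forall i, `|c i| < T) -> \sum_(i < n) c i * T ^+ i = 0 -> forall i, c i = 0.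
Proof.
elim: n c => [|n IHn] c cT; first by move=> _ [].
rewrite big_ord_recl expr0 mulr1.
under eq_bigr do rewrite /= /bump add1n exprS mulrCA.
rewrite -mulr_sumr => c0.
have T0 : 0 < T by apply: le_lt_trans (cT ord0).
have c00 : c ord0 = 0.
  have := cT ord0; move: c0; set s := \sum_(i < n) _; set a := c ord0.
  move=> e aT; have [s0|s0] := eqVneq s 0; first by move: e; rewrite s0; lia.
  have : T * 1 <= T * `|s| by rewrite ler_pM2l //; lia.
  by nia.
have {}c0 : \sum_(i < n) c (lift ord0 i) * T ^+ i = 0.
  move: c0; rewrite c00 add0r => /eqP; rewrite mulf_eq0 gt_eqF //=.
  by move/eqP.
move=> i; case: (unliftP ord0 i) => [j ->|-> //].
exact: IHn (fun j => cT (lift ord0 j)) c0 j.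
Qed.

Lemma digits_bound (T K : int) n (c : 'I_n -> int) : 1 <= T ->
  (forall i, `|c i| <= K) -> `|\sum_(i < n) c i * T ^+ i| <= n%:Z * K * T ^+ n.
Proof.
move=> T1 cK; apply: le_trans (ler_norm_sum _ _ _) _.
have -> : n%:Z * K * T ^+ n = \sum_(i < n) K * T ^+ n.
  by rewrite sumr_const card_ord -[RHS]mulr_natl natz mulrA.
apply: ler_sum => i _; rewrite normrM ler_pM ?normr_ge0 //.
by rewrite ger0_norm ?exprn_ge0 ?ler_weXn2l ?(le_trans ler01 T1) // ltnW.
Qed.

End Digits.

(** * The perturbed grid *)

Section Configuration.
Variables (D m : nat) (T U Q : int).
Let S := T * U.
Local Notation index := {ffun 'I_D -> 'I_m}.
Implicit Types (x y z v : index) (l : 'I_D) (t : 'I_m).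

Definition shift x l t : index := [ffun j => if j == l then t else x j].

(* Moving along direction l changes xcoord by multiples of T^l and slope_sum by
   l times as much, so that without bend the line would have slope Q l; bend
   turns it into a parabola opening upwards for even l, downwards for odd l. *)
Definition xcoord x : int := \sum_(l < D) (x l)%:Z * T ^+ l.
Definition slope_sum x : int := \sum_(l < D) (l%:Z * (x l)%:Z) * T ^+ l.
Definition bend x : int :=
  \sum_(l < D) ((-1) ^+ l * (x l)%:Z ^+ 2) * (T * U) ^+ l.
Definition ycoord x : int := Q * slope_sum x + bend x.
(** Up to the factor [Q], the intercept of the unbent line through [x] in direction [l]. The [l]-th
    coordinate has coefficient zero, so the value is constant on the line. *)
Definition offset l x : int := \sum_(j < D) ((j%:Z - l%:Z) * (x j)%:Z) * T ^+ j.

Lemma offsetE l x : slope_sum x - l%:Z * xcoord x = offset l x.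
Proof.
rewrite /slope_sum /xcoord mulr_sumr -sumrB; apply: eq_bigr => j _; ring.
Qed.

Lemma shift_id x l : shift x l (x l) = x.
Proof. by apply/ffunP => j; rewrite ffunE; case: eqP => // ->. Qed.

Lemma eq_shift x y l t : (forall j, j != l -> x j = y j) ->
  shift x l t = shift y l t.
Proof.
by move=> xy; apply/ffunP => j; rewrite !ffunE; case: eqVneq => // /xy.
Qed.

Lemma sum_shift (F : 'I_D -> int -> int) x l t :
  \sum_(j < D) F j (shift x l t j)%:Z =
  \sum_(j < D) F j (x j)%:Z + (F l t%:Z - F l (x l)%:Z).
Proof.
rewrite (bigD1 l) //= [in RHS](bigD1 l) //= ffunE eqxx.
under eq_bigr => j jl do rewrite ffunE (negPf jl).
ring.
Qed.

Lemma xcoord_shift x l t :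
  xcoord (shift x l t) = xcoord x + (t%:Z - (x l)%:Z) * T ^+ l.
Proof.
by rewrite /xcoord (sum_shift (fun j a => a * T ^+ j)) mulrBl.
Qed.

Lemma offset_shift x l t : offset l (shift x l t) = offset l x.
Proof.
rewrite /offset (sum_shift (fun j a => ((j%:Z - l%:Z) * a) * T ^+ j)); ring.
Qed.

Lemma bend_shift x l t : bend (shift x l t) =
  bend x + (-1) ^+ l * (t%:Z ^+ 2 - (x l)%:Z ^+ 2) * S ^+ l.
Proof.
rewrite /bend (sum_shift (fun j a => ((-1) ^+ j * a ^+ 2) * (T * U) ^+ j)) /S.
ring.
Qed.

Definition xbound : int := D%:Z * m%:Z * T ^+ D.
Definition bbound : int := D%:Z * m%:Z ^+ 2 * (T * U) ^+ D.

(** Three nested scales: [T] separates the digits of coordinates, [U] makes [T * U] separate those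
    of bends, and nonzero multiples of [Q] outweigh all bends. *)
Hypothesis T_large : 6 * D%:Z ^+ 2 * m%:Z + 2 * m%:Z ^+ 3 < T.
Hypothesis U_large : 8 * D%:Z * m%:Z ^+ 2 + 2 * xbound * m%:Z ^+ 2 < U.
Hypothesis Q_large :
  (4 * D%:Z + 4 * xbound + 16 * m%:Z * U ^+ D) * (bbound + 1) < Q.

Lemma T_ge1 : 1 <= T.
Proof.
have : 0 <= 6 * D%:Z ^+ 2 * m%:Z + 2 * m%:Z ^+ 3.
  by rewrite addr_ge0 // !mulr_ge0 // exprn_ge0.
by move: T_large; lia.
Qed.

Lemma xbound_ge0 : 0 <= xbound.
Proof. by rewrite !mulr_ge0 // exprn_ge0 // (le_trans _ T_ge1). Qed.

Lemma U_ge1 : 1 <= U.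
Proof.
have : 0 <= 8 * D%:Z * m%:Z ^+ 2 + 2 * xbound * m%:Z ^+ 2.
  by rewrite addr_ge0 // !mulr_ge0 // ?exprn_ge0 // (le_trans _ T_ge1).
by move: U_large; lia.
Qed.

Lemma S_ge1 : 1 <= S.
Proof. by rewrite /S -[1]mulr1 ler_pM ?T_ge1 ?U_ge1. Qed.

Lemma U_le_S : U <= S.
Proof. by rewrite /S ler_peMl ?T_ge1 // (le_trans _ U_ge1). Qed.

Lemma bbound_ge0 : 0 <= bbound.
Proof. by rewrite !mulr_ge0 ?exprn_ge0 // (le_trans _ S_ge1). Qed.

Lemma Q_bounds :
  [/\ 0 < Q, 4 * D%:Z * bbound < Q, 4 * xbound * bbound < Q
    & 16 * m%:Z * U ^+ D * (bbound + 1) < Q].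
Proof.
have b0 := bbound_ge0; have x0 := xbound_ge0.
have u0 : 0 <= 16 * m%:Z * U ^+ D.
  by rewrite !mulr_ge0 ?exprn_ge0 // (le_trans _ U_ge1).
move: Q_large u0; set u := 16 * _ * _; move: b0 x0.
move: bbound xbound => b x b0 x0 Qu u0.
by split; nia.
Qed.

Lemma ord_normB (i j : 'I_m) : `|i%:Z - j%:Z| <= m%:Z.
Proof. by have := ltn_ord i; have := ltn_ord j; lia. Qed.

Lemma bend_bound x : `|bend x| <= bbound.
Proof.
apply: digits_bound; first exact: S_ge1.
move=> l; rewrite normrM normrX normrN1 expr1n mul1r ger0_norm ?exprn_ge0 //.
by rewrite lerXn2r ?nnegrE // lez_nat ltnW.
Qed.

Lemma xcoord_bound x y : `|xcoord x - xcoord y| <= xbound.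
Proof.
rewrite /xcoord -sumrB; under eq_bigr do rewrite -mulrBl.
by apply: digits_bound; [exact: T_ge1 | move=> l; exact: ord_normB].
Qed.

Lemma xcoord_inj : injective xcoord.
Proof.
move=> x y /eqP; rewrite -subr_eq0 /xcoord -sumrB.
under eq_bigr do rewrite -mulrBl.
move/eqP/digits_eq0 => xy; apply/ffunP => l; apply/val_inj => /=.
suff : (x l)%:Z - (y l)%:Z = 0 by lia.
apply: xy => j; have := ord_normB (x j) (y j); have := T_large.
have mj := leq_ltn_trans (leq0n _) (ltn_ord (x j)).
have Dj := leq_ltn_trans (leq0n _) (ltn_ord j).
by nia.
Qed.

(** The factor [j - l] vanishes only for [j = l], so the digits in base [T] recover all other
    coordinates. *)
Lemma offset_inj l x y : offset l x = offset l y ->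
  forall j, j != l -> x j = y j.
Proof.
move=> /eqP; rewrite -subr_eq0 /offset -sumrB.
under eq_bigr do rewrite -mulrBl -mulrBr.
move/eqP/digits_eq0 => xy j jl; apply/val_inj => /=.
have : (j%:Z - l%:Z) * ((x j)%:Z - (y j)%:Z) = 0.
  apply: xy => i; rewrite normrM; have := T_large.
  have mi := leq_ltn_trans (leq0n _) (ltn_ord (x i)).
  have Di := leq_ltn_trans (leq0n _) (ltn_ord i).
  have il : `|i%:Z - l%:Z| <= D%:Z.
    by have := ltn_ord i; have := ltn_ord l; lia.
  have := ler_pM (normr_ge0 _) (normr_ge0 _) il (ord_normB (x i) (y i)).
  have : D%:Z * m%:Z <= D%:Z ^+ 2 * m%:Z by nia.
  have : 0 <= m%:Z ^+ 3 by rewrite exprn_ge0.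
  by lia.
move/eqP; rewrite mulf_eq0 => /orP[/eqP e|/eqP]; last by lia.
by case/eqP: jl; apply/val_inj => /=; lia.
Qed.

(** * General position of the grid *)

Lemma ord_sqrB (i j : 'I_m) : `|i%:Z ^+ 2 - j%:Z ^+ 2| <= m%:Z ^+ 2.
Proof.
have sq (k : 'I_m) : 0 <= k%:Z ^+ 2 <= m%:Z ^+ 2.
  by rewrite exprn_ge0 // lerXn2r ?nnegrE // lez_nat ltnW.
by have := sq i; have := sq j; lia.
Qed.

(** Collinearity splits scale by scale: [Q] isolates the bends, base [S] the squares of single
    coordinates, base [T] the coordinates. Their differences are then in a common ratio, which makes
    two of the points coincide. *)
Lemma grid_collinear_free x y z : x != y -> x != z -> y != z ->
  (xcoord y - xcoord x) * (ycoord z - ycoord x) !=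
  (xcoord z - xcoord x) * (ycoord y - ycoord x).
Proof.
move=> xy xz yz; apply/eqP => det0.
have [Q0 _ Q4 _] := Q_bounds.
set a := xcoord y - xcoord x in det0; set a' := xcoord z - xcoord x in det0.
have bendE : a' * (bend y - bend x) = a * (bend z - bend x).
  (* The part of the determinant due to the slopes: an integer whose product with [Q] is balanced by
     bends smaller than [Q], hence zero. *)
  pose h := a * (slope_sum z - slope_sum x) - a' * (slope_sum y - slope_sum x).
  have hE : Q * h = a' * (bend y - bend x) - a * (bend z - bend x).
    have -> : Q * h = a * (ycoord z - ycoord x) - a' * (ycoord y - ycoord x) +
        a' * (bend y - bend x) - a * (bend z - bend x).
      by rewrite /h /ycoord; ring.
    by rewrite det0; ring.
  have bd u v w : `|(xcoord u - xcoord x) * (bend v - bend w)| <=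
      xbound * (2 * bbound).
    rewrite normrM ler_pM ?xcoord_bound //.
    have := bend_bound v; have := bend_bound w; lia.
  have h0 : h = 0.
    apply/eqP; apply: contraT => h0.
    have : Q * 1 <= Q * `|h| by rewrite ler_pM2l //; lia.
    rewrite -[Q in Q * `|h|]gtr0_norm // -normrM hE.
    have := bd z y x; have := bd y z x; rewrite -/a -/a'; lia.
  by move: hE; rewrite h0; lia.
have sq l : a' * ((y l)%:Z ^+ 2 - (x l)%:Z ^+ 2) =
            a * ((z l)%:Z ^+ 2 - (x l)%:Z ^+ 2).
  pose c l := (-1) ^+ l * (a' * ((y l)%:Z ^+ 2 - (x l)%:Z ^+ 2) -
                           a * ((z l)%:Z ^+ 2 - (x l)%:Z ^+ 2)) : int.
  have c0 : \sum_(l < D) c l * S ^+ l = 0.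
    transitivity (a' * (bend y - bend x) - a * (bend z - bend x)); last lia.
    rewrite /bend -!sumrB !mulr_sumr -sumrB; apply: eq_bigr => j _.
    by rewrite /c /S; ring.
  suff : c l = 0.
    by rewrite /c => /eqP; rewrite mulf_eq0 signr_eq0 subr_eq0 => /eqP.
  apply: (digits_eq0 _ c0) => j.
  rewrite /c normrM normrX normrN1 expr1n mul1r.
  apply: lt_le_trans U_le_S; apply: le_lt_trans U_large.
  have bd u (v w : index) :
      `|(xcoord u - xcoord x) * ((v j)%:Z ^+ 2 - (w j)%:Z ^+ 2)| <=
      xbound * m%:Z ^+ 2.
    by rewrite normrM ler_pM ?xcoord_bound ?ord_sqrB //.
  have := bd z y x; have := bd y z x; rewrite -/a -/a'.
  have : 0 <= D%:Z * m%:Z ^+ 2 by rewrite mulr_ge0 ?exprn_ge0.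
  by lia.
have [l yl] : exists l, y l != x l.
  apply/existsP; rewrite -negb_forall; apply: contra xy => /forallP yx.
  by apply/eqP/ffunP => l; rewrite (eqP (yx l)).
have a0 : a' != 0 by rewrite subr_eq0 (inj_eq xcoord_inj) eq_sym.
set p := (z l)%:Z ^+ 2 - (x l)%:Z ^+ 2.
set q := (y l)%:Z ^+ 2 - (x l)%:Z ^+ 2.
have q0 : q != 0.
  by apply: contra yl; rewrite /q subr_eq0 eqrXn2.
have pq : a * p = a' * q by rewrite sq.
(* Read [a * p = a' * q] in base [T]: [p] and [q] are at most [m ^ 2] in size, so the digits are at
   most [2 * m ^ 3]. *)
have prop j : p * ((y j)%:Z - (x j)%:Z) = q * ((z j)%:Z - (x j)%:Z).
  pose c j := p * ((y j)%:Z - (x j)%:Z) - q * ((z j)%:Z - (x j)%:Z).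
  have c0 : \sum_(j < D) c j * T ^+ j = 0.
    transitivity (p * a - q * a'); last by rewrite mulrC pq mulrC subrr.
    rewrite /a /a' /xcoord -!sumrB !mulr_sumr -sumrB.
    by apply: eq_bigr => i _; rewrite /c; ring.
  suff : c j = 0 by rewrite /c; lia.
  apply: (digits_eq0 _ c0) => i; apply: le_lt_trans T_large.
  have bd (u v w t : 'I_m) :
      `|(u%:Z ^+ 2 - v%:Z ^+ 2) * (w%:Z - t%:Z)| <= m%:Z ^+ 3.
    by rewrite exprS mulrC normrM ler_pM ?ord_normB ?ord_sqrB //.
  apply: le_trans (ler_normB _ _) _; apply: le_trans (lerD (bd _ _ _ _)
    (bd _ _ _ _)) _.
  have : 0 <= 6 * D%:Z ^+ 2 * m%:Z by rewrite !mulr_ge0 ?exprn_ge0.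
  clear; lia.
(* For [j = l], [prop] says that a Vandermonde determinant vanishes. *)
have : ((z l)%:Z - (x l)%:Z) * (((y l)%:Z - (x l)%:Z) *
    ((z l)%:Z - (y l)%:Z)) = 0.
  rewrite -(subrr (p * ((y l)%:Z - (x l)%:Z))) {2}prop /p /q; ring.
move/eqP; rewrite !mulf_eq0 => /orP[zx|/orP[yx|zy]].
- case/eqP: xz; apply/ffunP => j; apply/val_inj => /=.
  have p0 : p = 0 by rewrite /p subr_sqr (eqP zx) mul0r.
  have := prop j; rewrite p0 mul0r => /esym/eqP; rewrite mulf_eq0 (negPf q0) /=.
  by move/eqP; lia.
- by case/eqP: yl; apply/val_inj => /=; move/eqP: yx; lia.
- case/eqP: yz; apply/ffunP => j; apply/val_inj => /=.
  have pq' : p = q.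
    by move: zy; rewrite /p /q subr_eq0 => /eqP ->.
  have := prop j; rewrite pq' => /(mulfI q0); lia.
Qed.

(** * Concurrent grid lines *)

(** The determinant condition for three lines of slopes [i], [j], [k] and intercepts [offset] to
    meet in a point. *)
Definition concurrent (xs : 'I_D -> index) (i j k : 'I_D) : Prop :=
  (j%:Z - k%:Z) * offset i (xs i) + (k%:Z - i%:Z) * offset j (xs j) +
  (i%:Z - j%:Z) * offset k (xs k) = 0.

Lemma concurrent_digits xs i j k (q : 'I_D) : concurrent xs i j k ->
  (j%:Z - k%:Z) * ((q%:Z - i%:Z) * (xs i q)%:Z) +
  (k%:Z - i%:Z) * ((q%:Z - j%:Z) * (xs j q)%:Z) +
  (i%:Z - j%:Z) * ((q%:Z - k%:Z) * (xs k q)%:Z) = 0.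
Proof.
pose c (q : 'I_D) := (j%:Z - k%:Z) * ((q%:Z - i%:Z) * (xs i q)%:Z) +
  (k%:Z - i%:Z) * ((q%:Z - j%:Z) * (xs j q)%:Z) +
  (i%:Z - j%:Z) * ((q%:Z - k%:Z) * (xs k q)%:Z).
rewrite /concurrent /offset !mulr_sumr -!big_split /= => c0.
suff : c q = 0 by [].
apply: (@digits_eq0 T D c); last first.
  by rewrite -[RHS]c0; apply: eq_bigr => r _; rewrite /c; ring.
move=> r; apply: le_lt_trans T_large.
have ordD (u v : 'I_D) : `|u%:Z - v%:Z| <= D%:Z.
  by have := ltn_ord u; have := ltn_ord v; lia.
have bd (u v w t : 'I_D) (s : 'I_m) :
    `|(u%:Z - v%:Z) * ((w%:Z - t%:Z) * s%:Z)| <= D%:Z ^+ 2 * m%:Z.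
  rewrite mulrA !normrM ler_pM ?mulr_ge0 // ?expr2 ?ler_pM ?ordD //.
  by have := ltn_ord s; lia.
apply: le_trans (ler_normD _ _) _.
apply: le_trans (lerD (le_trans (ler_normD _ _)
  (lerD (bd _ _ _ _ _) (bd _ _ _ _ _))) (bd _ _ _ _ _)) _.
have : 0 <= m%:Z ^+ 3 by rewrite exprn_ge0.
have : 0 <= D%:Z ^+ 2 * m%:Z by rewrite mulr_ge0 ?exprn_ge0.
clear; lia.
Qed.

(* For fixed q, the q-th coordinate of the line in direction k is a Moebius
   function of k, hence constant once it takes a value twice: pigeonhole. *)
Lemma common_vertex (L : {set 'I_D}) xs : (m + 1 < #|L|)%N ->
  (forall i j k, i \in L -> j \in L -> k \in L -> concurrent xs i j k) ->
  exists v, forall l, l \in L -> forall j, j != l -> xs l j = v j.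
Proof.
move=> mL conc.
have [v vP] : exists v : 'I_D -> 'I_m, forall q l, l \in L -> q != l ->
    xs l q = v q.
  apply: (@fin_all_exists _ _ (fun q c => forall l, l \in L -> q != l ->
    xs l q = c)) => q.
  (* Without [q] there are still more than [m] directions for [m] values. *)
  have /dinjectivePn[i iL [j /andP[ji jL] ij]] :
      ~~ dinjectiveb (fun k => xs k q) (L :\ q).
    apply/negP => /dinjectiveP inj.
    move: mL; rewrite ltnNge (cardsD1 q L) addnC leq_add ?leq_b1 //.
    by rewrite -[X in (_ <= X)%N]card_ord; exact: leq_card_in inj.
  move: iL jL; rewrite !inE => /andP[iq iL] /andP[jq jL].
  exists (xs i q) => k kL qk; apply/val_inj => /=.
  have := concurrent_digits q (conc i j k iL jL kL); rewrite -ij => e.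
  (* With equal values at [i] and [j] the relation factors; the first two factors are nonzero. *)
  have : (i%:Z - j%:Z) * ((q%:Z - k%:Z) * ((xs k q)%:Z - (xs i q)%:Z)) = 0.
    by rewrite -[RHS]e; ring.
  move/eqP; rewrite !mulf_eq0 !subr_eq0 !eqz_nat.
  rewrite -!(inj_eq val_inj) in ji qk.
  by rewrite eq_sym (negPf ji) (negPf qk) /= => /eqP.
exists [ffun q => v q] => l lL j jl; rewrite ffunE; exact: vP.
Qed.

Lemma ycoordE l x :
  ycoord x = Q * l%:Z * xcoord x + Q * offset l x + bend x.
Proof. by rewrite /ycoord -(offsetE l); ring. Qed.

(** * Points in the hulls of the grid lines *)

Variable R : realType.
Implicit Types b : plane R.

Definition point x : plane R :=
  \row_(j < 2) (if j == 0 then (xcoord x)%:~R else (ycoord x)%:~R).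

Lemma point0 x : point x 0 0 = (xcoord x)%:~R.
Proof. by rewrite mxE. Qed.

Lemma point1 x : point x 0 1 = (ycoord x)%:~R.
Proof. by rewrite mxE. Qed.

Lemma point_inj : injective point.
Proof.
move=> x y xy; apply: xcoord_inj; apply/eqP; rewrite -(eqr_int R).
by rewrite -!point0 xy.
Qed.

Definition chain x l (A : set 'I_m) : set (plane R) :=
  [set point (shift x l t) | t in A]%classic.

Lemma chain_ge (a1 a2 c : int) x l A :
  (forall t, A t ->
    c <= a1 * xcoord (shift x l t) + a2 * ycoord (shift x l t)) ->
  forall b, convex_hull (chain x l A) b ->
    c%:~R <= a1%:~R * b 0 0 + a2%:~R * b 0 1.
Proof.
move=> cA b bA; apply: (hull_ge _ bA) => _ [t At <-].
by rewrite /lform point0 point1 -!intrM -intrD ler_int cA.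
Qed.

Definition hit b l x : Prop := convex_hull (chain x l setT) b.

(* A point of the hull that is not deep lies in an ear of the convex chain, so
   discarding a single vertex of the chain removes it from the hull. *)
Definition deep b l x : Prop :=
  hit b l x /\ forall t, convex_hull (chain x l [set s | s != t]%classic) b.

Lemma eq_hit b l x y : (forall j, j != l -> x j = y j) ->
  hit b l x -> hit b l y.
Proof.
move=> xy; rewrite /hit /chain.
by under eq_imagel => t _ do rewrite (eq_shift t xy).
Qed.

Lemma eq_deep b l x y : (forall j, j != l -> x j = y j) ->
  deep b l x -> deep b l y.
Proof.
move=> xy [xh xd]; split; first exact: eq_hit xh.
move=> t; move: (xd t); rewrite /chain.
by under eq_imagel => s _ do rewrite (eq_shift s xy).
Qed.

(** Signed vertical deviation from the unbent line through [x] in direction [l]; a grid point of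
    that line has its [bend] as defect. *)
Definition defect b l x : R :=
  b 0 1 - (Q * l%:Z)%:~R * b 0 0 - (Q * offset l x)%:~R.

Lemma hit_defect b l x : hit b l x -> `|defect b l x| <= bbound%:~R.
Proof.
move=> h; rewrite ler_norml; apply/andP; split.
  have : (Q * offset l x - bbound)%:~R <=
      (- (Q * l%:Z))%:~R * b 0 0 + 1%:~R * b 0 1.
    apply: (chain_ge _ h) => t _.
    have := bend_bound (shift x l t); rewrite (ycoordE l) offset_shift.
    by move: (xcoord _) (bend _) => X B; lia.
  by rewrite /defect rmorphB rmorphN mulNr mul1r /=; lra.
have : (- (Q * offset l x) - bbound)%:~R <=
    (Q * l%:Z)%:~R * b 0 0 + (- 1)%:~R * b 0 1.
  apply: (chain_ge _ h) => t _.
  have := bend_bound (shift x l t); rewrite (ycoordE l) offset_shift.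
  by move: (xcoord _) (bend _) => X B; lia.
by rewrite /defect rmorphB !rmorphN mulNr mul1r /=; lra.
Qed.

Lemma multiple_small (N c : int) : `|Q * N| <= c -> c < Q -> N = 0.
Proof.
move=> Nc cQ; apply/eqP; apply: contraT => N0.
have [Q0 _ _ _] := Q_bounds.
have : Q * 1 <= Q * `|N| by rewrite ler_pM2l //; lia.
by rewrite -[Q in Q * `|N|]gtr0_norm // -normrM; lia.
Qed.

(** Intercepts of parallel lines differ by multiples of [Q], but [b] deviates from each line it hits
    by at most [bbound]. *)
Lemma hit_inj b l x y : hit b l x -> hit b l y ->
  forall j, j != l -> x j = y j.
Proof.
move=> /hit_defect xh /hit_defect yh; apply: (offset_inj (l := l)).
have [_ Q4 _ _] := Q_bounds.
apply/eqP; rewrite -subr_eq0; apply/eqP.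
apply: (@multiple_small _ (2 * bbound)).
  rewrite -(ler_int R) intr_norm mulrBr rmorphB [X in _ <= X]rmorphM /=.
  have -> : (Q * offset l x)%:~R - (Q * offset l y)%:~R =
      defect b l y - defect b l x by rewrite /defect; ring.
  by apply: le_trans (ler_normB _ _) _; lra.
apply: le_lt_trans Q4; have := bbound_ge0.
by have := leq_ltn_trans (leq0n _) (ltn_ord l); nia.
Qed.

(** [Q] times the determinant is a combination of three defects with coefficients at most [D] in
    size, hence smaller than [Q]. *)
Lemma hit_concurrent b xs i j k :
  hit b i (xs i) -> hit b j (xs j) -> hit b k (xs k) -> concurrent xs i j k.
Proof.
move=> /hit_defect ih /hit_defect jh /hit_defect kh; rewrite /concurrent.
have [_ Q4 _ _] := Q_bounds.
have D0 := leq_ltn_trans (leq0n _) (ltn_ord i).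
apply: (@multiple_small _ (3 * (D%:Z * bbound))); last first.
  by apply: le_lt_trans Q4; have := bbound_ge0; nia.
rewrite -(ler_int R) intr_norm.
have -> : (Q * ((j%:Z - k%:Z) * offset i (xs i) +
    (k%:Z - i%:Z) * offset j (xs j) + (i%:Z - j%:Z) * offset k (xs k)))%:~R =
  - ((j%:Z - k%:Z)%:~R * defect b i (xs i) +
     (k%:Z - i%:Z)%:~R * defect b j (xs j) +
     (i%:Z - j%:Z)%:~R * defect b k (xs k)).
  by rewrite /defect; rewrite !(rmorphM, rmorphD, rmorphB) /=; ring.
have ordD (u v : 'I_D) : `|(u%:Z - v%:Z)%:~R| <= D%:Z%:~R :> R.
  rewrite -intr_norm ler_int.
  by have := ltn_ord u; have := ltn_ord v; lia.
have bd (u v : 'I_D) e : `|e| <= bbound%:~R ->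
    `|(u%:Z - v%:Z)%:~R * e| <= (D%:Z * bbound)%:~R :> R.
  by move=> eb; rewrite normrM rmorphM /= ler_pM ?ordD.
rewrite normrN; apply: le_trans (ler_normD _ _) _.
apply: le_trans (lerD (le_trans (ler_normD _ _)
  (lerD (bd _ _ _ ih) (bd _ _ _ jh))) (bd _ _ _ kh)) _.
by rewrite [X in _ <= X]rmorphM /=; lra.
Qed.

(** * Position of a Breaker point relative to a grid vertex *)

Definition dx b x : R := b 0 0 - (xcoord x)%:~R.
Definition dy b x : R := b 0 1 - (ycoord x)%:~R.
(** Vertical deviation of [b] from the line of slope [Q * l] through [x]. Being affine in [l], it
    links the different directions. *)
Definition psi b x (l : nat) : R := dy b x - (Q * l%:Z)%:~R * dx b x.

Lemma psi_defect b l x : psi b x l = defect b l x - (bend x)%:~R.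
Proof.
rewrite /psi /defect /dx /dy (ycoordE l).
by rewrite !(rmorphM, rmorphD) /=; ring.
Qed.

Lemma hit_psi b l x : hit b l x -> `|psi b x l| <= (2 * bbound)%:~R.
Proof.
move=> /hit_defect h; rewrite psi_defect; have := bend_bound x.
rewrite -(ler_int R) intr_norm => bx.
by apply: le_trans (ler_normB _ _) _; rewrite rmorphM /=; lra.
Qed.

Lemma hit_top b l x : hit b l x ->
  ((-1) ^+ l)%:~R * psi b x l <= (m%:Z ^+ 2 * S ^+ l)%:~R.
Proof.
move=> h; rewrite -lerN2.
set s := (-1) ^+ l.
have : (s * (Q * l%:Z * xcoord x - ycoord x) - m%:Z ^+ 2 * S ^+ l)%:~R <=
    (s * (Q * l%:Z))%:~R * b 0 0 + (- s)%:~R * b 0 1.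
  apply: (chain_ge _ h) => t _.
  rewrite !(ycoordE l) offset_shift bend_shift -/s.
  have ss : s * s = 1 by rewrite /s -expr2 sqrr_sign.
  have sq : t%:Z ^+ 2 - (x l)%:Z ^+ 2 <= m%:Z ^+ 2.
    by apply: le_trans (ler_norm _) (ord_sqrB _ _).
  have := ler_wpM2r (exprn_ge0 l (le_trans ler01 S_ge1)) sq.
  rewrite -[X in X * S ^+ l <= _]mul1r -{1}ss => le.
  rewrite -subr_ge0; rewrite -subr_ge0 in le; apply: le_trans le _.
  by rewrite le_eqVlt; apply/orP; left; apply/eqP; ring.
rewrite /psi /dx /dy !(rmorphM, rmorphB, rmorphN) /=; lra.
Qed.

(* The form (tangent l x, (-1)^l) is minimised on the parabola through x in
   direction l at x itself. *)
Definition tangent l x : int :=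
  - ((-1) ^+ l * (Q * l%:Z)) - 2 * (x l)%:Z * U ^+ l.

(** Completing the square: [U ^ l] in [tangent] times the spacing [T ^ l] is the weight [S ^ l] of
    the bend. *)
Lemma tangentE x l t :
  tangent l x * xcoord (shift x l t) + (-1) ^+ l * ycoord (shift x l t) =
  tangent l x * xcoord x + (-1) ^+ l * ycoord x +
  S ^+ l * (t%:Z - (x l)%:Z) ^+ 2.
Proof.
have ss : (-1) ^+ l * (-1) ^+ l = 1 :> int by rewrite -expr2 sqrr_sign.
rewrite !(ycoordE l) offset_shift bend_shift xcoord_shift /tangent.
move: ss; move: ((-1) ^+ l) => s ss.
move: (xcoord x) (offset l x) (bend x) => X o e.
apply/eqP; rewrite -subr_eq0.
rewrite [X in X == 0](_ : _ =
  (s * s - 1) * (S ^+ l * (t%:Z ^+ 2 - (x l)%:Z ^+ 2))).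
  by rewrite ss subrr mul0r.
by rewrite /S exprMn; ring.
Qed.

(** Serves with [c = 0] for whole lines and with [c = S ^ l] for chains that omit [x]. *)
Lemma chain_tangent b l x A : convex_hull (chain x l A) b ->
  forall c : int, (forall t, A t -> c <= S ^+ l * (t%:Z - (x l)%:Z) ^+ 2) ->
  c%:~R <= ((-1) ^+ l)%:~R * psi b x l - (2 * (x l)%:Z * U ^+ l)%:~R * dx b x.
Proof.
move=> h c cA.
have : (c + (tangent l x * xcoord x + (-1) ^+ l * ycoord x))%:~R <=
    (tangent l x)%:~R * b 0 0 + ((-1) ^+ l)%:~R * b 0 1.
  apply: (chain_ge _ h) => t At.
  by rewrite tangentE addrC lerD2l cA.
rewrite /psi /dx /dy /tangent; move: ((-1) ^+ l) => s.
by rewrite !(rmorphM, rmorphB, rmorphN, rmorphD) /=; lra.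
Qed.

Lemma psiB b v (i j : nat) :
  psi b v i - psi b v j = (j%:Z - i%:Z)%:~R * (Q%:~R * dx b v).
Proof. by rewrite /psi !(rmorphM, rmorphB) /=; ring. Qed.

(** Bounds the contribution of the slope correction in [tangent], uniformly in the direction. *)
Definition slack b v : R := (2 * m%:Z * U ^+ D)%:~R * `|dx b v|.

Lemma slack_lt b v : dx b v != 0 -> 2 * slack b v < Q%:~R * `|dx b v|.
Proof.
move=> d0; rewrite /slack mulrA ltr_pM2r ?normr_gt0 //.
have -> : (2 : R) = 2%:~R by [].
rewrite -intrM ltr_int; have [_ _ _] := Q_bounds; apply: le_lt_trans.
have : 0 <= m%:Z * U ^+ D by rewrite mulr_ge0 ?exprn_ge0 // (le_trans _ U_ge1).
by have := bbound_ge0; nia.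
Qed.

Lemma chain_slack b l x A (c : int) : convex_hull (chain x l A) b ->
  (forall t, A t -> c <= S ^+ l * (t%:Z - (x l)%:Z) ^+ 2) ->
  c%:~R - slack b x <= ((-1) ^+ l)%:~R * psi b x l.
Proof.
move=> h cA; have := chain_tangent h cA.
have : `|(2 * (x l)%:Z * U ^+ l)%:~R * dx b x| <= slack b x.
  have U0 := le_trans ler01 U_ge1.
  rewrite normrM ler_wpM2r // ger0_norm; last first.
    by rewrite ler0z !mulr_ge0 // exprn_ge0.
  rewrite ler_int ler_pM ?mulr_ge0 ?exprn_ge0 //.
    by rewrite ler_pM2l // lez_nat ltnW.
  by rewrite ler_weXn2l ?U_ge1 // ltnW.
by rewrite ler_norml => /andP[]; lra.
Qed.

Lemma hit_slack b l x : hit b l x ->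
  - slack b x <= ((-1) ^+ l)%:~R * psi b x l.
Proof.
move=> h; have := @chain_slack b l x setT 0 h; rewrite sub0r; apply=> t _.
by rewrite mulr_ge0 ?sqr_ge0 ?exprn_ge0 // (le_trans _ S_ge1).
Qed.

(** Bounds on [psi] in two directions bound [Q * dx] by [4 * bbound], and [Q] dwarfs the factor in
    [slack]. *)
Lemma dx_small b v i j : i != j -> hit b i v -> hit b j v ->
  2 * slack b v <= 1.
Proof.
move=> ij /hit_psi hi /hit_psi hj.
have Qdx : Q%:~R * `|dx b v| <= (4 * bbound)%:~R.
  have [Q0 _ _ _] := Q_bounds.
  rewrite -[Q in Q%:~R]gtr0_norm // intr_norm -normrM.
  apply: (@le_trans _ _ `|psi b v i - psi b v j|); last first.
    apply: le_trans (ler_normB _ _) _; move: hi hj.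
    by rewrite !rmorphM /=; lra.
  rewrite psiB [leRHS]normrM ler_peMl // -intr_norm ler1z.
  by move: ij; rewrite -(inj_eq val_inj) /=; lia.
rewrite leNgt; apply/negP => s1.
have [_ _ _ Qu] := Q_bounds.
have b0 := bbound_ge0.
have u0 : 0 <= m%:Z * U ^+ D.
  by rewrite mulr_ge0 ?exprn_ge0 // (le_trans _ U_ge1).
have d0 : 0 <= `|dx b v| by [].
have : (4 * (bbound + 1))%:~R * (2 * slack b v) <= Q%:~R * `|dx b v|.
  rewrite /slack !mulrA; apply: ler_wpM2r => //.
  have -> : (2 : R) = 2%:~R by [].
  by rewrite -!intrM ler_int; apply: le_trans (ltW Qu); lia.
have : 0 < (4 * (bbound + 1))%:~R :> R by rewrite ltr0z; lia.
move=> B0 le.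
have lt : (4 * (bbound + 1))%:~R * 1 < (4 * (bbound + 1))%:~R * (2 * slack b v).
  by rewrite ltr_pM2l.
have := lt_le_trans lt (le_trans le Qdx).
by rewrite mulr1 ltr_int; clear; lia.
Qed.

(** Depth allows omitting [v] itself, which raises the tangent bound to [S ^ l]; the slack takes at
    most half of it. *)
Lemma deep_psi b l i v : hit b i v -> i != l -> deep b l v ->
  (S ^+ l)%:~R <= 2 * `|psi b v l| /\ `|psi b v l| <= (m%:Z ^+ 2 * S ^+ l)%:~R.
Proof.
move=> hi il [hl /(_ (v l)) dl].
have s1 := dx_small il hi hl.
have Sl : 1 <= (S ^+ l)%:~R :> R.
  by rewrite ler1z exprn_ege1 // S_ge1.
have : (S ^+ l)%:~R - slack b v <= ((-1) ^+ l)%:~R * psi b v l.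
  apply: chain_slack dl _ => t /= tv.
  rewrite ler_peMr ?exprn_ge0 ?(le_trans _ S_ge1) //.
  by have : t != v l :> nat by []; nia.
have -> : `|psi b v l| = `|((-1) ^+ l)%:~R * psi b v l|.
  by rewrite normrM -intr_norm normrX normrN1 expr1n mul1r.
have := hit_top hl; move: (_ * psi b v l) => p pS Sp.
by rewrite ger0_norm; lra.
Qed.

(* psi is affine in the direction, but on deep directions it is squeezed between
   multiples of the rapidly growing weights S^l. *)
Lemma three_deep b v (i j l : 'I_D) : (i < j)%N -> (j < l)%N ->
  deep b i v -> deep b j v -> deep b l v -> False.
Proof.
move=> ij jl di dj dl.
have neq (p q : 'I_D) : (p < q)%N -> p != q.
  by move=> pq; rewrite -(inj_eq val_inj) /= ltn_eqF.
have ji : j != i by rewrite eq_sym neq.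
have [_ pi] := deep_psi dj.1 ji di.
have [_ pj] := deep_psi di.1 (neq _ _ ij) dj.
have [pl _] := deep_psi dj.1 (neq _ _ jl) dl.
have S0 := lt_le_trans ltr01 S_ge1.
have Sij : S ^+ i <= S ^+ j by rewrite ler_weXn2l ?S_ge1 // ltnW.
have {}pi : `|psi b v i| <= (m%:Z ^+ 2 * S ^+ j)%:~R.
  by apply: le_trans pi _; rewrite ler_int ler_wpM2l ?exprn_ge0.
have Sjl : S * S ^+ j <= S ^+ l by rewrite -exprS ler_weXn2l ?S_ge1.
have affine : (j%:Z - i%:Z)%:~R * psi b v l =
    (l%:Z - i%:Z)%:~R * psi b v j - (l%:Z - j%:Z)%:~R * psi b v i.
  by rewrite /psi !(rmorphM, rmorphB) /=; ring.
have coef (p q : 'I_D) : (p < q)%N -> 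
    1 <= ((q%:Z - p%:Z)%:~R : R) <= D%:Z%:~R.
  move=> pq; rewrite ler1z ler_int.
  by have := ltn_ord q; lia.
have [/andP[c1 _] /andP[c2 c3]] := (coef _ _ ij, coef _ _ jl).
have /andP[c4 c5] := coef _ _ (ltn_trans ij jl).
(* Extrapolation from [i] and [j] gives order [S ^ j], whereas depth at [l] demands at least half of
   [S * S ^ j]. *)
have : `|psi b v l| <= (2 * D%:Z * (m%:Z ^+ 2 * S ^+ j))%:~R.
  apply: (@le_trans _ _ `|(j%:Z - i%:Z)%:~R * psi b v l|).
    by rewrite normrM ler_peMl // (le_trans c1) // ler_norm.
  rewrite affine; apply: le_trans (ler_normB _ _) _.
  rewrite !normrM.
  rewrite (ger0_norm (le_trans ler01 c4)) (ger0_norm (le_trans ler01 c2)).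
  apply: le_trans (lerD (ler_pM _ _ c5 pj) (ler_pM _ _ c3 pi)) _ => //.
  - exact: le_trans ler01 c4.
  - exact: le_trans ler01 c2.
  by rewrite -!intrM -intrD ler_int; clear; lia.
move=> pl'.
have : (S ^+ l)%:~R <= (4 * D%:Z * (m%:Z ^+ 2 * S ^+ j))%:~R :> R.
  apply: le_trans pl _.
  have -> : (4 * D%:Z * (m%:Z ^+ 2 * S ^+ j))%:~R =
      2 * (2 * D%:Z * (m%:Z ^+ 2 * S ^+ j))%:~R :> R.
    by rewrite !rmorphM /=; ring.
  by rewrite ler_pM2l.
rewrite ler_int => /(le_trans Sjl).
rewrite !mulrA ler_pM2r ?exprn_gt0 // leNgt => /negP; apply.
apply: lt_le_trans U_le_S; apply: le_lt_trans U_large.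
have : 0 <= xbound * m%:Z ^+ 2 by rewrite mulr_ge0 ?xbound_ge0 ?exprn_ge0.
have : 0 <= D%:Z * m%:Z ^+ 2 by rewrite mulr_ge0 ?exprn_ge0.
by clear; lia.
Qed.

(* psi is affine in the direction and has sign (-1)^l, up to slack, on the
   directions l that are hit. *)
Lemma two_hit_pairs b v (i i' j j' : 'I_D) :
  i' = i.+1 :> nat -> j' = j.+1 :> nat -> ~~ odd i -> ~~ odd j -> (i < j)%N ->
  hit b i v -> hit b i' v -> hit b j v -> b = point v.
Proof.
move=> i'E j'E oi oj ij /hit_slack hi /hit_slack hi' /hit_slack hj.
have ij' : (i' < j)%N by move: i'E oi oj ij; lia.
have [Q0 _ _ _] := Q_bounds.
move: hi hi' hj; rewrite -signr_odd (negPf oi) mul1r => hi.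
rewrite -signr_odd i'E /= oi expr1 mulN1r -i'E => hi'.
rewrite -signr_odd (negPf oj) mul1r => hj.
have e1 : psi b v i - psi b v i' = Q%:~R * dx b v.
  by rewrite psiB (_ : i'%:Z - i%:Z = 1) ?mul1r //; move: i'E; clear; lia.
have e2 := psiB b v i' j.
(* If [dx] were nonzero, passing from even [i] to odd [i'] would make it positive, and from [i'] to
   even [j] negative. *)
have d0 : dx b v = 0.
  apply/eqP; apply: contraT => d0; have sl := slack_lt d0.
  have {e2}e2 : Q%:~R * dx b v < 0.
    have c : 1 <= (j%:Z - i'%:Z)%:~R :> R by rewrite ler1z; lia.
    move: e2; rewrite ltNge => e2; apply/negP => dq.
    have := ler_wpM2r dq c; rewrite mul1r -e2.
    have : `|Q%:~R * dx b v| = Q%:~R * `|dx b v|.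
      by rewrite normrM ger0_norm // ler0z ltW.
    by rewrite ger0_norm // => ->; lra.
  have : `|Q%:~R * dx b v| = Q%:~R * `|dx b v|.
    by rewrite normrM ger0_norm // ler0z ltW.
  by rewrite ltr0_norm //; lra.
have sl0 : slack b v = 0 by rewrite /slack d0 normr0 mulr0.
have dy0 : dy b v = 0.
  by move: hi hi'; rewrite sl0 /psi d0 !mulr0 !subr0; lra.
apply/rowP => c; have [->|c1] := eqVneq c 0.
  by rewrite point0; move: d0; rewrite /dx; lra.
have -> : c = 1 by apply/val_inj; case: c c1 => -[|[|]].
by rewrite point1; move: dy0; rewrite /dy; lra.
Qed.

(** * Counting the lines met by one Breaker point *)

(** Pair each even direction with its successor. At most one pair lies fully in [L]; dropping one of
    its members makes halving injective. *)
Lemma card_halves (L : {set 'I_D}) :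
  (forall i i' j j', i \in L -> i' \in L -> j \in L -> j' \in L ->
    i' = i.+1 :> nat -> j' = j.+1 :> nat -> ~~ odd i -> ~~ odd j ->
    ~~ (i < j)%N) ->
  (#|L| <= (uphalf D).+1)%N.
Proof.
move=> pairs.
have hlt l : (l./2 < uphalf D)%N by have := ltn_ord l; lia.
pose h l := Ordinal (hlt l).
have inj_card (A : {set 'I_D}) : {in A &, injective h} -> (#|A| <= uphalf D)%N.
  by move=> inj; rewrite -[X in (_ <= X)%N]card_ord; exact: leq_card_in inj.
have halfE i j : h i = h j -> (i < j)%N -> ~~ odd i /\ j = i.+1 :> nat.
  by move=> [] e ij; split; lia.
have [/dinjectiveP/inj_card/leqW //|/dinjectivePn[i iL [j jD ij]]] :=
  boolP (dinjectiveb h L).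
move: jD; rewrite !inE => /andP[ji jL].
wlog lt_ij : i j iL jL ij ji / (i < j)%N.
  move=> wl; have [lt|gt|/val_inj e] := ltngtP i j.
  - exact: (wl i j).
  - by apply: (wl j i); rewrite // eq_sym.
  - by rewrite e eqxx in ji.
have [oi jE] := halfE _ _ ij lt_ij.
rewrite (cardsD1 i) iL add1n ltnS; apply: inj_card => p q.
rewrite !inE => /andP[pi pL] /andP[qi qL].
wlog lt_pq : p q pi qi pL qL / (p < q)%N => [wl pq|].
  have [lt|gt|/val_inj //] := ltngtP p q; first exact: wl.
  by apply/esym/wl.
move=> /halfE /(_ lt_pq)[op qE]; exfalso.
have := pairs _ _ _ _ iL jL pL qL jE qE oi op.
have := pairs _ _ _ _ pL qL iL jL qE jE op oi.
by move: pi; rewrite -(inj_eq val_inj) /=; lia.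
Qed.

(** Each direction has at most one flagged line, whose [m] vertices are told apart by [x l]. *)
Lemma card_flags (F : 'I_D -> index -> Prop) :
  (forall l x y, F l x -> F l y -> forall j, j != l -> x j = y j) ->
  (#|[set f : 'I_D * index | `[< F f.1 f.2 >]]| <=
   #|[set l | `[< exists x, F l x >]]| * m)%N.
Proof.
move=> Finj; set L := [set l | _]; set A := [set f | _].
have inj : {in A &, injective (fun f : 'I_D * index => (f.1, f.2 f.1))}.
  move=> [l x] [k y]; rewrite !finset.in_set /= => /asboolP lx /asboolP ky [lk].
  case: _ / lk ky => ky xy; congr pair; apply/ffunP => j.
  by have [->|jl] := eqVneq j l; [exact: xy|exact: (Finj _ _ _ lx ky j jl)].
rewrite -(card_in_imset inj) -[X in (_ * X)%N]card_ord -cardsT -cardsX.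
apply/subset_leq_card/fintype.subsetP => _ /imsetP[[l x] + ->].
rewrite finset.in_setX !finset.in_set andbT => /asboolP lx.
by apply/asboolP; exists x.
Qed.

Lemma hit_vertex b (L := [set l | `[< exists x, hit b l x >]]) :
  (#|L| <= m + 1)%N \/ exists v, forall l, l \in L -> hit b l v.
Proof.
have [|mL] := leqP #|L| (m + 1); [by left | right].
have [l0 l0L] : exists l, l \in L.
  by apply/set0Pn; rewrite -card_gt0 (leq_ltn_trans _ mL).
have [x0 _] : exists x, hit b l0 x.
  by move: l0L; rewrite finset.in_set => /asboolP.
have [xs xsP] : exists xs : 'I_D -> index, forall l, l \in L -> hit b l (xs l).
  apply: (@fin_all_exists _ _ (fun l x => l \in L -> hit b l x)) => l.
  have [|nL] := boolP (l \in L); last by exists x0.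
  by rewrite finset.in_set => /asboolP[x hx]; exists x.
have [v vP] := common_vertex mL
  (fun i j k iL jL kL => hit_concurrent (xsP i iL) (xsP j jL) (xsP k kL)).
by exists v => l lL; apply: eq_hit (vP l lL) (xsP l lL).
Qed.

(** If the lines share a vertex, two fully hit pairs would put [b] on the grid; otherwise at most
    [m + 1] directions are hit. *)
Lemma card_hit b : (forall x, b <> point x) -> (m <= uphalf D)%N ->
  (#|[set f : 'I_D * index | `[< hit b f.1 f.2 >]]| <= (uphalf D).+1 * m)%N.
Proof.
move=> bP mD.
apply: leq_trans (card_flags (fun l x y => @hit_inj b l x y)) _.
rewrite leq_mul2r; apply/orP; right.
have [Lm|[v vP]] := hit_vertex b; first by apply: leq_trans Lm _; rewrite addn1.
apply: card_halves => i i' j j' iL i'L jL _ iE jE oi oj; apply/negP => ij.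
exact: (bP v) (two_hit_pairs iE jE oi oj ij (vP i iL) (vP i' i'L) (vP j jL)).
Qed.

(** Either at most [m + 1] directions are hit, or all hit lines share a vertex and [three_deep]
    leaves two. *)
Lemma card_deep b :
  (#|[set f : 'I_D * index | `[< deep b f.1 f.2 >]]| <= m.+2 * m)%N.
Proof.
apply: leq_trans (card_flags _) _.
  by move=> l x y [hx _] [hy _]; exact: hit_inj hx hy.
rewrite leq_mul2r; apply/orP; right.
have [Lm|[v vP]] := hit_vertex b.
  apply: leq_trans (leq_trans Lm _); last by rewrite addn1.
  apply/subset_leq_card/fintype.subsetP => l; rewrite !finset.in_set.
  by move=> /asboolP[x [hx _]]; apply/asboolP; exists x.
apply: (@leq_trans 2) => //; rewrite leqNgt; apply/negP => /card_gt2P.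
move=> [i [j [l [[]]]]]; rewrite !finset.in_set => iD jD lD [ij jl li].
have dv p : `[< exists x, deep b p x >] -> deep b p v.
  move=> /asboolP[x dx]; apply: (eq_deep (hit_inj dx.1 (vP p _)) dx).
  by rewrite finset.in_set; apply/asboolP; exists x; case: dx.
move: iD jD lD => /dv di /dv dj /dv dl.
(* Sort the three directions; the two cyclic cases are absurd. *)
move: ij jl li; rewrite -!(inj_eq val_inj) /=.
case: ltngtP => // ij _; case: ltngtP => // jl _; case: ltngtP => // li _.
- by lia.
- exact: (three_deep (i := i) (j := j) (l := l) _ _ di dj dl).
- exact: (three_deep (i := l) (j := i) (l := j) _ _ dl di dj).
- exact: (three_deep (i := i) (j := l) (l := j) _ _ di dl dj).
- exact: (three_deep (i := j) (j := l) (l := i) _ _ dj dl di).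
- exact: (three_deep (i := j) (j := i) (l := l) _ _ dj di dl).
- exact: (three_deep (i := l) (j := j) (l := i) _ _ dl dj di).
- by lia.
Qed.

(** * Holes among the vertices of a grid line *)

Lemma shift_shift x l s t : shift (shift x l s) l t = shift x l t.
Proof. by apply/ffunP => j; rewrite !ffunE; case: eqP. Qed.

Lemma point_hit x l : hit (point x) l x.
Proof. by apply: subset_hull; exists (x l); rewrite // shift_id. Qed.

(** [hit_inj] puts [z] on the line; were its coordinate missing from [A], the tangent at [z] would
    cut it off. *)
Lemma chain_point x l A z : convex_hull (chain x l A) (point z) ->
  exists2 t, A t & z = shift x l t.
Proof.
move=> zA; have zx : hit (point z) l x.
  by apply: hull_mono zA => _ [t _ <-]; exists t.
have zE : z = shift x l (z l).
  apply/ffunP => j; rewrite ffunE; have [->//|jl] := eqVneq j l.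
  by rewrite (hit_inj zx (@point_hit z l)).
exists (z l) => //; apply: contrapT => nA.
have : convex_hull (chain z l A) (point z).
  apply: hull_mono zA => _ [t At <-]; exists t => //.
  by rewrite zE shift_shift.
move/chain_tangent => /(_ (S ^+ l)).
have -> : psi (point z) z l = 0.
  by rewrite /psi /dy /dx point0 point1 !subrr mulr0 subr0.
rewrite /dx point0 !subrr !mulr0 subr0 lerz0 => S0.
have S1 : 1 <= S ^+ l by rewrite exprn_ege1 ?S_ge1.
suff /S0 /(le_trans S1) : forall t, A t ->
    S ^+ l <= S ^+ l * (t%:Z - (z l)%:Z) ^+ 2 by rewrite ler10.
move=> t At; rewrite ler_peMr ?(le_trans ler01) //.
have : t != z l :> nat by apply/eqP => /val_inj tz; rewrite tz in At.
by nia.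
Qed.

Lemma chain_extreme x l A :
  extreme_points (convex_hull (chain x l A)) = chain x l A.
Proof.
apply: extreme_points_hull => _ [s As <-].
exists (tangent l (shift x l s))%:~R, ((-1) ^+ l)%:~R => _ [t At <-].
have [->|ts] := eqVneq t s; [by left|right].
rewrite /lform !point0 !point1 -!intrM -!intrD ltr_int.
rewrite -(shift_shift x l s t) tangentE ltrDl mulr_gt0 //.
  by rewrite exprn_gt0 // (lt_le_trans _ S_ge1).
by rewrite exprn_even_gt0 //= subr_eq0 ffunE eqxx eqz_nat.
Qed.

Definition configuration : {fset plane R} :=
  [fset point x | x in {: index}]%fset.

Lemma configurationP p :
  reflect (exists x, p = point x) (p \in configuration).
Proof.
by apply: (iffP (imfsetP _ _ _ _)) => [[x _ ->]|[x ->]]; exists x.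
Qed.

Lemma card_configuration : #|` configuration| = (m ^ D)%N.
Proof.
rewrite card_imfset; last exact: point_inj.
by rewrite /= -cardE card_ffun !card_ord.
Qed.

Lemma configuration_general_position : general_position configuration.
Proof.
move=> A AM A3 colA.
have := fset_uniq A; move: A3; rewrite /= => A3 uA.
have inA p : p \in enum_fset A -> exists2 x, p = point x & [set` A]%classic p.
  by move=> pA; have /configurationP[x px] := fsubsetP AM _ pA; exists x.
move: A3 uA inA; case: (enum_fset A) => [|p [|q [|r []]]] //= _.
rewrite !inE !andbT negb_or => /andP[/andP[pq pr] qr] inA.
have [x px Ap] := inA p (mem_head _ _).
have [|y qy Aq] := inA q; first by rewrite !inE eqxx orbT.
have [|z rz Ar] := inA r; first by rewrite !inE eqxx !orbT.
rewrite px qy rz in pq pr qr.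
have := collinear_det colA Ap Aq Ar; rewrite px qy rz !point0 !point1.
rewrite -!intrB -!intrM => /eqP; rewrite eqr_int; apply/negP.
by apply: grid_collinear_free; rewrite -(inj_eq point_inj).
Qed.

Lemma chain_hole (B : {fset plane R}) k x l (A : {set 'I_m}) :
  (3 <= k)%N -> #|A| = k ->
  (forall b, b \in B -> ~ convex_hull (chain x l [set` A]) b) ->
  exists H : {fset plane R},
    hole k (configuration `|` B)%fset H /\ (H `<=` configuration)%fset.
Proof.
move=> k3 Ak AB.
pose H := [fset point (shift x l t) | t in A]%fset.
have HE : [set` H]%classic = chain x l [set` A].
  apply/seteqP; split => [p /imfsetP[t /= tA ->]|p [t /= tA <-]].
    by exists t.
  by apply/imfsetP; exists t.
have HM : (H `<=` configuration)%fset.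
  apply/fsubsetP => p /imfsetP[t _ ->].
  by apply/configurationP; exists (shift x l t).
have Hk : #|` H| = k.
  rewrite card_imfset /=; first by rewrite -cardE.
  by move=> s t /point_inj /ffunP /(_ l); rewrite !ffunE eqxx.
exists H; split => //; split => //.
- exact: fsubset_trans HM (fsubsetUl _ _).
- by split=> //; exists H; rewrite HE; split=> //; exact: chain_extreme.
rewrite HE; apply/seteqP; split => [p [/= pA]|p pA].
  rewrite in_fsetU => /orP[/configurationP[z pz]|/AB //].
  by move: pA; rewrite pz => /chain_point[t At ->]; exists t.
split; first exact: subset_hull.
by rewrite -HE in pA; rewrite /= in_fsetU (fsubsetP HM _ pA).
Qed.

(** Every point that hits the line is expelled by discarding one vertex, and at least [k] vertices
    survive. *)
Lemma shallow_chain_hole (B : {fset plane R}) k x l :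
  (3 <= k)%N ->
  (forall b, b \in B -> ~ deep b l x) ->
  (#|[set b : B | `[< hit (val b) l x >]]| + k <= m)%N ->
  exists H : {fset plane R},
    hole k (configuration `|` B)%fset H /\ (H `<=` configuration)%fset.
Proof.
move=> k3 shallow few.
have [e eP] : exists e : B -> 'I_m, forall b : B, hit (val b) l x ->
    ~ convex_hull (chain x l [set s | s != e b]%classic) (val b).
  apply: (@fin_all_exists _ _ (fun (b : B) t => hit (val b) l x ->
    ~ convex_hull (chain x l [set s | s != t]%classic) (val b))) => b.
  apply: contrapT => /forallNP nt; apply: (shallow _ (valP b)); split.
    by have /not_implyP[] := nt (x l).
  by move=> t; have /not_implyP[_ /contrapT] := nt t.
set hits := [set b : B | _] in few.
have /card_geqP[s [us sk sE]] : (k <= #|~: (e @: hits)|)%N.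
  rewrite cardsCs card_ord finset.setCK.
  apply: leq_trans (leq_sub2l m (leq_imset_card e _)).
  by rewrite leq_subRL // (leq_trans (leq_addr _ _) few).
apply: (@chain_hole _ _ x l [set t in s]) => //.
  by rewrite cardsE -sk; apply/card_uniqP.
move=> b bB bs.
have bh : hit b l x by apply: hull_mono bs => _ [t _ <-]; exists t.
apply: (eP [` bB]%fset bh); apply: hull_mono bs => _ [t + <-].
rewrite /= finset.in_set => /sE; rewrite finset.in_setC => nt; exists t => //=.
apply: contra nt => /eqP ->; apply: imset_f.
by rewrite finset.in_set; apply/asboolP.
Qed.

(* Every line is either met deeply or has at least m + 1 - k points of B in its
   hull; the claim sums this over all pairs (direction, vertex). *)
Lemma breaker_cost (B : {fset plane R}) k :
  (3 <= k)%N -> (k <= m)%N -> (m <= uphalf D)%N ->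
  (configuration `&` B)%fset = fset0 ->
  (forall H : {fset plane R}, hole k (configuration `|` B)%fset H ->
    ~ (H `<=` configuration)%fset) ->
  (D * m ^ D * (m.+1 - k) <=
   #|` B| * (m * ((uphalf D).+1 + (m.+1 - k) * m.+2)))%N.
Proof.
move=> k3 km mD MB noH.
set w := (m.+1 - k)%N.
pose hits (f : 'I_D * index) := #|[set b : B | `[< hit (val b) f.1 f.2 >]]|.
pose deeps (f : 'I_D * index) := #|[set b : B | `[< deep (val b) f.1 f.2 >]]|.
(* With weight [w], one deep point pays for a whole line. *)
have cost f : (w <= hits f + w * deeps f)%N.
  rewrite leqNgt; apply/negP => lt.
  have d0 : deeps f = 0%N by nia.
  have [||H [Hh HM]] := @shallow_chain_hole B k f.2 f.1 k3.
  - move=> b bB bd; move/eqP: d0.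
    rewrite cards_eq0 => /eqP/setP/(_ [` bB]%fset).
    by rewrite finset.in_set finset.in_set0 => /asboolP; apply.
  - by move: lt; rewrite d0 muln0 addn0 /hits /w; lia.
  exact: noH Hh HM.
have notM (b : B) y : val b <> point y.
  move=> b_y; have : val b \in (configuration `&` B)%fset.
    by rewrite in_fsetI (valP b) andbT; apply/configurationP; exists y.
  by rewrite MB in_fset0.
(* Double counting of incidences between flags and Breaker's points. *)
have swap (F : plane R -> 'I_D * index -> Prop) c :
  (forall b : B, #|[set f | `[< F (val b) f >]]| <= c)%N ->
  (\sum_f #|[set b : B | `[< F (val b) f >]]| <= #|` B| * c)%N.
  move=> Fc; under eq_bigr => f _ do rewrite -sum1_card big_mkcond /=.
  rewrite exchange_big /= cardfE -sum_nat_const; apply: leq_sum => b _.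
  apply: leq_trans (Fc b); rewrite -sum1_card [leqRHS]big_mkcond /=.
  by apply: leq_sum => f _; rewrite !finset.in_set.
have hitsS : (\sum_f hits f <= #|` B| * ((uphalf D).+1 * m))%N.
  by apply: (swap (fun b f => hit b f.1 f.2)) => b; exact: card_hit.
have deepsS : (\sum_f deeps f <= #|` B| * (m.+2 * m))%N.
  by apply: (swap (fun b f => deep b f.1 f.2)) => b; exact: card_deep.
have -> : (D * m ^ D * w = \sum_(f : 'I_D * index) w)%N.
  by rewrite sum_nat_const card_prod card_ffun !card_ord.
apply: (@leq_trans (\sum_f (hits f + w * deeps f))).
  by apply: leq_sum => f _; exact: cost.
rewrite big_split -big_distrr /=.
apply: leq_trans (leq_add hitsS (leq_mul (leqnn w) deepsS)) _.
rewrite [X in (_ + X)%N]mulnCA -mulnDr leq_mul2l; apply/orP; right.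
by clear; lia.
Qed.

End Configuration.

(** Each bound involves earlier parameters only. *)
Lemma parameters_exist (D m : nat) : exists T U Q : int,
  [/\ 6 * D%:Z ^+ 2 * m%:Z + 2 * m%:Z ^+ 3 < T,
      8 * D%:Z * m%:Z ^+ 2 + 2 * xbound D m T * m%:Z ^+ 2 < U &
      (4 * D%:Z + 4 * xbound D m T + 16 * m%:Z * U ^+ D) *
        (bbound D m T U + 1) < Q].
Proof.
have lt_add1 (c : int) : c < c + 1 by rewrite ltrDl.
by do 3 eexists; split; exact: lt_add1.
Qed.

Theorem theorem13 (R : realType) (eps : R) (k : nat) :
  0 < eps -> (3 <= k)%N ->
  exists (n : nat) (M : {fset plane R}),
    [/\ #|` M| = n,
        general_position M
      & forall B : {fset plane R},
          #|` B|%:R <= (2 - eps) * n%:R ->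
          (M `&` B)%fset = fset0 ->
          general_position (M `|` B)%fset ->
          exists H : {fset plane R}, hole k (M `|` B)%fset H /\ (H `<=` M)%fset].
Proof.
move=> eps0 k3.
(* This gives [2 * k <= eps * m]: the loss of [k] per line fits into the margin. *)
pose m := (k + Num.bound (2 * k%:R / eps))%N.
(* Half the number of directions, one more than the bound on the lower-order terms. *)
pose d := (m * (1 + m * (m + 2)) + 1)%N.
have km : (k <= m)%N := leq_addr _ _.
have m_large : 2 * k%:R <= eps * m%:R.
  rewrite [leRHS]mulrC -ler_pdivrMr //.
  apply: (@le_trans _ _ (Num.bound (2 * k%:R / eps))%:R).
    by rewrite ltW // archi_boundP // divr_ge0 ?mulr_ge0 // ltW.
  by rewrite ler_nat leq_addl.
have [T [U [Q [hT hU hQ]]]] := parameters_exist d.*2 m.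
exists (m ^ d.*2)%N, (configuration d.*2 m T U Q R); split.
- exact: card_configuration.
- exact: configuration_general_position.
move=> B Bsmall MB _; apply: contrapT => /forallNP noH.
have md : (m <= uphalf d.*2)%N.
  by rewrite uphalf_double (leq_trans _ (leq_addr 1 _)) // leq_pmulr.
have := breaker_cost hT hU hQ k3 km md MB (fun H Hh HM => noH H (conj Hh HM)).
rewrite uphalf_double -(ler_nat R) -mul2n !natrM natrX.
have n0 : 0 < m%:R ^+ (2 * d) :> R.
  by rewrite exprn_gt0 // ltr0n (leq_trans _ km) // (leq_trans _ k3).
rewrite -mul2n natrX in Bsmall.
set n := m%:R ^+ (2 * d) in n0 Bsmall *; set w := (m.+1 - k)%N.
have w_m : (w <= m)%N by rewrite /w; lia.
set c := (d.+1 + w * m.+2)%N.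
have c0 : 0 <= m%:R * c%:R :> R by rewrite mulr_ge0.
(* Cancelling [n] leaves [2 * d * w <= (2 - eps) * (m * c)], to be refuted. *)
move=> /le_trans /(_ (ler_wpM2r c0 Bsmall)).
rewrite mulrAC -[X in _ <= X]mulrA [n * _]mulrC mulrA ler_pM2r // leNgt.
move=> /negP; apply.
have wE : w%:R = m%:R + 1 - k%:R :> R by rewrite natrB ?natr1 // leqW.
have dE : d%:R = m%:R * (1 + m%:R * (m%:R + 2)) + 1 :> R.
  by rewrite !(natrD, natrM).
have cE : c%:R = d%:R + 1 + w%:R * (m%:R + 2) :> R.
  by rewrite natrD natrM -[d.+1]addn1 -[m.+2]addn2 !natrD.
have h1 : (2 - eps) * (m%:R * d%:R) <= 2 * m%:R * d%:R - 2 * k%:R * d%:R.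
  have := ler_wpM2r (ler0n R d) m_large; lra.
have h2 : (2 - eps) * (m%:R * (1 + w%:R * (m%:R + 2))) <= 2 * d%:R - 2.
  have r0 : 0 <= m%:R * (1 + w%:R * (m%:R + 2)) :> R.
    by rewrite mulr_ge0 // addr_ge0 // mulr_ge0 // addr_ge0.
  apply: (@le_trans _ _ (2 * (m%:R * (1 + w%:R * (m%:R + 2))))).
    by rewrite ler_wpM2r //; lra.
  have : m%:R * (1 + w%:R * (m%:R + 2)) <= m%:R * (1 + m%:R * (m%:R + 2)) :> R.
    by rewrite ler_wpM2l // lerD2l ler_wpM2r ?ler_nat.
  by rewrite dE; lra.
have -> : (2 - eps) * (m%:R * c%:R) = (2 - eps) * (m%:R * d%:R) +
    (2 - eps) * (m%:R * (1 + w%:R * (m%:R + 2))) by rewrite cE; ring.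
apply: le_lt_trans (lerD h1 h2) _.
(* The [+ 1] in [w] yields [2 * d], which beats the remaining [2 * d - 2]. *)
by rewrite wE; lra.
Qed.
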